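(* Consider the equation $$\mathbf{D}_{s,t}y(x)=\alpha\big(ay(x)+by(ux)\big)+\beta(x),\qquad y(0)=a_0,$$ where $\alpha$ is a constant and $\beta(x)$ is an analytic function with expansion $\beta(x)=\sum_{n=0}^{\infty}b_nx^n$. Then its (power series) solution is given by $$y(x)=a_0\,\mathrm{E}_{s,t}(a,b;\alpha x,u)+\sum_{n=1}^{\infty}\left(\sum_{k=0}^{n-1}\frac{\{k\}_{s,t}!\,\alpha^{n-k-1}}{(a\oplus b)_{1,u}^{k+1}}\,b_k\right)(a\oplus b)_{1,u}^{n}\frac{x^n}{\{n\}_{s,t}!}.$$
   Context: Let $s,t\in\mathbb{R}$, $s\ne0$, $t\ne0$, $\varphi_{s,t}=\frac{s+\sqrt{s^2+4t}}{2}$, $\varphi_{s,t}'=\frac{s-\sqrt{s^2+4t}}{2}$. Put $\{0\}_{s,t}=0$, $\{1\}_{s,t}=1$, $\{n+2\}_{s,t}=s\{n+1\}_{s,t}+t\{n\}_{s,t}$, and $\{n\}_{s,t}!=\{1\}_{s,t}\cdots\{n\}_{s,t}$ ($\{0\}_{s,t}!=1$). The $(s,t)$-derivative is $(\mathbf{D}_{s,t}f)(x)=\frac{f(\varphi_{s,t}x)-f(\varphi_{s,t}'x)}{(\varphi_{s,t}-\varphi_{s,t}')x}$ for $x\ne0$, $(\mathbf{D}_{s,t}f)(0)=f'(0)$; on power series it acts by $\mathbf{D}_{s,t}x^n=\{n\}_{s,t}x^{n-1}$. For constants $a,b$ and $u\in\mathbb{C}$ put $(a\oplus b)_{1,u}^{0}=1$,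 $(a\oplus b)_{1,u}^{n}=\prod_{k=0}^{n-1}(a+bu^k)$ for $n\ge1$, and $\mathrm{E}_{s,t}(a,b;z,u)=\sum_{n\ge0}(a\oplus b)_{1,u}^{n}\frac{z^n}{\{n\}_{s,t}!}$. It is understood that $\varphi_{s,t}\neq\varphi_{s,t}'$, that $\{n\}_{s,t}\neq0$ for $n\ge1$, and that $a+bu^k\neq0$ for all $k\ge0$, so that all expressions make sense. Power series are treated formally (or on any common domain of convergence), and $0^0=1$. *)

(* Defs.v *)
From Stdlib Require Import Reals.
From Coquelicot Require Import Coquelicot.
Open Scope R_scope.

Section StCalculus.

Variables s t : R.

(* The principal square root of the real number [s^2 + 4t], which may be
   negative; [sqrt] vanishes on negative numbers, so one of the two
   components is always zero. *)
Definition st_sqrt_disc : C :=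
  (sqrt (s ^ 2 + 4 * t), sqrt (- (s ^ 2 + 4 * t))).

Definition phi : C := ((RtoC s + st_sqrt_disc) / RtoC 2)%C.

Definition phi' : C := ((RtoC s - st_sqrt_disc) / RtoC 2)%C.

Fixpoint stnum (n : nat) : R :=
  match n with
  | O => 0
  | S O => 1
  | S (S k as m) => s * stnum m + t * stnum k
  end.

Fixpoint stfact (n : nat) : R :=
  match n with
  | O => 1
  | S m => stfact m * stnum n
  end.

(* At [0] the value is the complex derivative; [C_derive] agrees with
   [is_derive] wherever the function is complex differentiable. *)
Definition st_derive (f : C -> C) (x : C) : C :=
  if Ceq_dec x (RtoC 0) then C_derive f (RtoC 0)
  else ((f (phi * x) - f (phi' * x)) / ((phi - phi') * x))%C.

End StCalculus.

(* A formal power series over C is its coefficient sequence [nat -> C];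
   [PS_plus], [PS_scal] and [PS_decr_1] are the coefficientwise sum, the
   product with a constant, and the division by the variable of a series
   without constant term. *)

(* The formal series of f(cx). *)
Definition PS_dilate (c : C) (f : nat -> C) : nat -> C :=
  fun n => (c ^ n * f n)%C.

(* The difference quotient (f(phi x) - f(phi' x)) / ((phi - phi') x),
   computed on formal series: the numerator has no constant term. *)
Definition PS_st_derive (s t : R) (f : nat -> C) : nat -> C :=
  PS_scal (V := C_NormedModule) (/ (phi s t - phi' s t))%C
    (PS_decr_1 (V := C_NormedModule)
      (PS_minus (V := C_NormedModule)
        (PS_dilate (phi s t) f) (PS_dilate (phi' s t) f))).

Fixpoint oplus_pow (a b u : C) (n : nat) : C :=
  match n with
  | O => RtoC 1
  | S k => (oplus_pow a b u k * (a + b * u ^ k))%C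
  end.

(* Coefficients of E_{s,t}(a, b; z, u) as a power series in z. *)
Definition st_exp (s t : R) (a b u : C) : nat -> C :=
  fun n => (oplus_pow a b u n / RtoC (stfact s t n))%C.

Definition st_particular (s t : R) (a b u alpha : C) (bn : nat -> C)
    : nat -> C :=
  fun n => match n with
  | O => RtoC 0
  | S _ =>
      (sum_n (fun k => RtoC (stfact s t k) * alpha ^ (n - k - 1)
                       / oplus_pow a b u (k + 1) * bn k) (n - 1)
       * oplus_pow a b u n / RtoC (stfact s t n))%C
  end.

(* The sum a0 * E_{s,t}(a, b; alpha x, u) + (particular series) is formed
   coefficientwise: the total may converge where neither summand does. *)
Definition st_solution (s t : R) (a b u alpha a0 : C) (bn : nat -> C)
    : nat -> C :=
  PS_plus (V := C_NormedModule)
    (PS_scal (V := C_NormedModule) a0 (PS_dilate alpha (st_exp s t a b u)))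
    (st_particular s t a b u alpha bn).

Definition has_expansion (f : nat -> C) (r : R) (F : C -> C) : Prop :=
  forall x : C, Cmod x < r ->
    is_pseries (K := C_AbsRing) (V := C_NormedModule) f x (F x).

(* Main.v *)
(** By Binet's formula the [(s,t)]-derivative multiplies the coefficient
    [y_(n+1)] by [{n+1}_(s,t)], so the equation is equivalent to the first-order
    recurrence [{n+1} y_(n+1) = alpha (a + b u^n) y_n + b_n], which the closed
    form solves and which determines [y] from [y_0] because [{n+1} <> 0].
    For analytic functions both sides of the equation are sums of power series
    near [0], so the identity theorem reduces the equation to the formal one. *)

Require Import Defs.
From Stdlib Require Import Reals Lra Lia.
From Coquelicot Require Import Coquelicot.
Open Scope R_scope.

(** * Complex power series near the origin *)

Lemma pow_n_Cpow (x : C) (n : nat) : pow_n (K := C_AbsRing) x n = (x ^ n)%C.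
Proof.
  induction n as [|n IH]; [reflexivity|].
  simpl. rewrite IH. reflexivity.
Qed.

Lemma C_norm_Cmod (x : C) :
  norm (K := C_AbsRing) (V := C_NormedModule) x = Cmod x.
Proof. reflexivity. Qed.

Lemma is_pseries_C_unique (f : nat -> C) (x l l' : C) :
  is_pseries (K := C_AbsRing) (V := C_NormedModule) f x l ->
  is_pseries (K := C_AbsRing) (V := C_NormedModule) f x l' -> l = l'.
Proof.
  intros H H'.
  exact (filterlim_locally_unique (V := C_NormedModule) _ _ _ H H').
Qed.

Lemma is_pseries_dilate (c : C) (f : nat -> C) (x l : C) :
  is_pseries (K := C_AbsRing) (V := C_NormedModule) f (c * x)%C l ->
  is_pseries (K := C_AbsRing) (V := C_NormedModule) (PS_dilate c f) x l.
Proof.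
  apply is_series_ext. intros n.
  rewrite (pow_n_Cpow (c * x)%C), (pow_n_Cpow x). change scal with Cmult. unfold PS_dilate.
  rewrite Cpow_mult_l.
  match goal with |- ?l = ?r => change (@eq C l r) end. ring.
Qed.

Lemma has_expansion_0 (f : nat -> C) (r : R) (F : C -> C) :
  0 < r -> has_expansion f r F -> F (RtoC 0) = f 0%nat.
Proof.
  intros hr hF.
  apply (is_pseries_C_unique f (RtoC 0)).
  - apply hF. rewrite Cmod_0. exact hr.
  - apply (is_pseries_0 (K := C_AbsRing) (V := C_NormedModule)).
Qed.

(** Cauchy's estimate without integrals: convergence at the single point [r / 2] bounds all terms
    there, and closer to 0 the series is dominated by a geometric one. *)
Lemma has_expansion_bounded (f : nat -> C) (r : R) (F : C -> C) :
  0 < r -> has_expansion f r F ->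
  exists M rho : R, 0 < rho <= r /\
    forall x : C, Cmod x < rho -> Cmod (F x) <= M.
Proof.
  intros hr hF.
  assert (hx0 : Cmod (RtoC (r / 2)) = r / 2)
    by (rewrite Cmod_R; apply Rabs_pos_eq; lra).
  assert (hconv := hF (RtoC (r / 2)) ltac:(rewrite hx0; lra)).
  destruct (filterlim_bounded (K := C_AbsRing) (V := C_NormedModule) _
              (ex_intro _ _ hconv)) as [M hM].
  (* Each term is the difference of two consecutive partial sums, both bounded by [M]; this is where
     the factor 2 comes from. *)
  assert (hterm : forall n, (r / 2) ^ n * Cmod (f n) <= 2 * M).
  { intros n.
    rewrite <- hx0, <- Cmod_pow, <- Cmod_mult.
    assert (hM0 := hM 0%nat).
    destruct n as [|n].
    - rewrite sum_O, C_norm_Cmod in hM0.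
      change (Cmod (1 * f 0%nat)%C <= M) in hM0.
      assert (hpos := Cmod_ge_0 (1 * f 0%nat)%C).
      simpl Cpow. lra.
    - assert (hn := hM n). assert (hSn := hM (S n)).
      rewrite C_norm_Cmod in hn, hSn. rewrite sum_Sn in hSn.
      rewrite pow_n_Cpow in hSn.
      change scal with Cmult in hSn. change plus with Cplus in hSn.
      set (S0 := sum_n _ n) in *.
      replace (RtoC (r / 2) ^ S n * f (S n))%C
        with ((S0 + RtoC (r / 2) ^ S n * f (S n)) + - S0)%C
        by (match goal with |- ?l = ?r => change (@eq C l r) end; ring).
      eapply Rle_trans; [apply Cmod_triangle|].
      rewrite Cmod_opp. lra. }
  (* For [Cmod x < r / 4] the [k]-th term is at most [2 * M * (1 / 2) ^ k], and these bounds sum to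
     at most [4 * M]. *)
  exists (4 * M), (r / 4). split; [lra|]. intros x hx.
  assert (hlim := hF x ltac:(lra)).
  assert (hnorm : is_lim_seq
     (fun n => norm (sum_n (fun k => scal (pow_n (K := C_AbsRing) x k) (f k) : C_NormedModule) n))
     (norm (F x : C_NormedModule))).
  { exact (filterlim_comp _ _ _ _ _ _ _ _ hlim
             (filterlim_norm (F x : C_NormedModule))). }
  rewrite C_norm_Cmod in hnorm.
  apply (is_lim_seq_le _ (fun _ => 4 * M) (Cmod (F x)) (4 * M) ) with (2 := hnorm);
    [|apply is_lim_seq_const].
  intros n.
  eapply Rle_trans; [apply (norm_sum_n_m (V := C_NormedModule))|].
  assert (hle : forall k, norm (scal (pow_n (K := C_AbsRing) x k) (f k) : C_NormedModule)
                  <= 2 * M * (1 / 2) ^ k).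
  { intros k. rewrite C_norm_Cmod, pow_n_Cpow. change scal with Cmult.
    rewrite Cmod_mult, Cmod_pow.
    apply Rle_trans with (((r / 2) ^ k * Cmod (f k)) * (1 / 2) ^ k).
    - replace ((r / 2) ^ k * Cmod (f k) * (1 / 2) ^ k)
        with ((r / 2 * (1 / 2)) ^ k * Cmod (f k))
        by (rewrite Rpow_mult_distr; ring).
      apply Rmult_le_compat_r; [apply Cmod_ge_0|].
      apply pow_incr. split; [apply Cmod_ge_0|lra].
    - apply Rmult_le_compat_r; [apply pow_le; lra|apply hterm]. }
  eapply Rle_trans; [apply sum_n_m_le, hle|].
  assert (hM' : 0 <= 2 * M)
    by (eapply Rle_trans; [|apply (hterm 0%nat)]; simpl;
        assert (h := Cmod_ge_0 (f 0%nat)); lra).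
  assert (hgeom : sum_n (fun k => 2 * M * (1 / 2) ^ k) n
                  = 2 * M * (2 - (1 / 2) ^ n)).
  { clear. induction n as [|n IH].
    - rewrite sum_O. simpl. ring.
    - rewrite sum_Sn, IH. change plus with Rplus. simpl. field. }
  change (sum_n (fun k => 2 * M * (1 / 2) ^ k) n <= 4 * M).
  rewrite hgeom.
  assert (h := pow_le (1 / 2) n ltac:(lra)). nra.
Qed.

(* The value at [0] is the constant coefficient of the quotient series. *)
Definition decr_quotient (f : nat -> C) (F : C -> C) (x : C) : C :=
  if Ceq_dec x (RtoC 0) then f 1%nat else ((F x - f 0%nat) / x)%C.

(** The radius does not shrink, so the quotient can be iterated to reach every coefficient. *)
Lemma has_expansion_decr (f : nat -> C) (r : R) (F : C -> C) :
  has_expansion f r F ->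
  has_expansion (PS_decr_1 (V := C_NormedModule) f) r (decr_quotient f F).
Proof.
  intros hF x hx. unfold decr_quotient.
  destruct (Ceq_dec x (RtoC 0)) as [->|hx0].
  - apply (is_pseries_0 (K := C_AbsRing) (V := C_NormedModule)).
  - replace ((F x - f 0%nat) / x)%C with (/ x * (F x - f 0%nat))%C
      by (unfold Cdiv; apply Cmult_comm).
    apply (is_pseries_decr_1 (K := C_AbsRing) (V := C_NormedModule)).
    + apply (Cinv_l x hx0).
    + apply hF, hx.
Qed.

(** The difference quotient has an expansion too, hence is bounded near 0. This stands in for
    continuity at 0, and for differentiability when applied to the quotient. *)
Lemma has_expansion_lipschitz_0 (f : nat -> C) (r : R) (F : C -> C) :
  0 < r -> has_expansion f r F ->
  exists M rho : R, 0 < rho <= r /\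
    forall x : C, Cmod x < rho -> Cmod (F x - f 0%nat)%C <= M * Cmod x.
Proof.
  intros hr hF.
  destruct (has_expansion_bounded _ r _ hr (has_expansion_decr _ _ _ hF))
    as (M & rho & hrho & hM).
  exists M, rho. split; [exact hrho|]. intros x hx.
  specialize (hM x hx). unfold decr_quotient in hM.
  destruct (Ceq_dec x (RtoC 0)) as [->|hx0].
  - rewrite (has_expansion_0 _ _ _ hr hF), Cmod_0.
    replace (f 0%nat - f 0%nat)%C with (RtoC 0) by ring.
    rewrite Cmod_0. lra.
  - replace (F x - f 0%nat)%C with ((F x - f 0%nat) / x * x)%C by (field; auto).
    rewrite Cmod_mult. apply Rmult_le_compat_r; [apply Cmod_ge_0|exact hM].
Qed.

(** Since [F] and [G] may differ at 0, the constant terms are compared through a common value at a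
    small nonzero point. *)
Lemma has_expansion_coef_0_unique (f g : nat -> C) (r : R) (F G : C -> C) :
  0 < r -> has_expansion f r F -> has_expansion g r G ->
  (forall x : C, x <> RtoC 0 -> Cmod x < r -> F x = G x) ->
  f 0%nat = g 0%nat.
Proof.
  intros hr hF hG hFG.
  destruct (has_expansion_lipschitz_0 _ _ _ hr hF) as (M & rho & hrho & hM).
  destruct (has_expansion_lipschitz_0 _ _ _ hr hG) as (N & sig & hsig & hN).
  apply Ceq_minus, Cmod_eq_0, Rle_antisym; [|apply Cmod_ge_0].
  apply Rnot_lt_le. intros hpos.
  set (d := Cmod (f 0%nat - g 0%nat)%C) in *.
  set (L := Rabs M + Rabs N + 1).
  assert (hMa := Rle_abs M). assert (hNa := Rle_abs N).
  assert (hM0 := Rabs_pos M). assert (hN0 := Rabs_pos N).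
  (* The point [e] lies inside both discs, and the two Lipschitz bounds at [e] give
     [d <= L * e <= d / 2], which contradicts [0 < d]. The [+ 1] in [L] keeps the divisor
     positive. *)
  set (e := Rmin (Rmin rho sig / 2) (d / (2 * L))).
  assert (he : 0 < e).
  { apply Rmin_pos; [apply Rdiv_lt_0_compat; [apply Rmin_pos; lra|lra]|].
    apply Rdiv_lt_0_compat; unfold L; lra. }
  assert (he1 : e < rho /\ e < sig).
  { assert (h := Rmin_l (Rmin rho sig / 2) (d / (2 * L))).
    assert (h1 := Rmin_l rho sig). assert (h2 := Rmin_r rho sig).
    fold e in h. lra. }
  assert (he2 : L * e <= d / 2).
  { apply Rle_trans with (L * (d / (2 * L))).
    - apply Rmult_le_compat_l; [unfold L; lra|apply Rmin_r].
    - right. field. unfold L. lra. }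
  assert (hem : Cmod (RtoC e) = e)
    by (rewrite Cmod_R; apply Rabs_pos_eq; lra).
  specialize (hM (RtoC e) ltac:(lra)). specialize (hN (RtoC e) ltac:(lra)).
  rewrite hem in hM, hN.
  rewrite hFG in hM by
    first [lra | intros h; apply RtoC_inj in h; lra].
  assert (hd : d <= Cmod (G (RtoC e) - g 0%nat)%C + Cmod (G (RtoC e) - f 0%nat)%C).
  { unfold d.
    replace (f 0%nat - g 0%nat)%C
      with ((G (RtoC e) - g 0%nat) + - (G (RtoC e) - f 0%nat))%C by ring.
    eapply Rle_trans; [apply Cmod_triangle|]. rewrite Cmod_opp. lra. }
  assert (M * e <= Rabs M * e) by (apply Rmult_le_compat_r; lra).
  assert (N * e <= Rabs N * e) by (apply Rmult_le_compat_r; lra).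
  unfold L in he2. lra.
Qed.

(** Identity theorem, by passing to difference quotients. Their values at 0 are the next
    coefficients, whose equality is still to be proved; agreement is therefore assumed only away
    from 0, a condition that the induction preserves. *)
Lemma has_expansion_coef_unique (n : nat) (f g : nat -> C) (r : R)
    (F G : C -> C) :
  0 < r -> has_expansion f r F -> has_expansion g r G ->
  (forall x : C, x <> RtoC 0 -> Cmod x < r -> F x = G x) ->
  f n = g n.
Proof.
  intros hr. revert f g F G.
  induction n as [|n IH]; intros f g F G hF hG hFG.
  - exact (has_expansion_coef_0_unique _ _ _ _ _ hr hF hG hFG).
  - assert (h0 := has_expansion_coef_0_unique _ _ _ _ _ hr hF hG hFG).
    apply (IH (PS_decr_1 (V := C_NormedModule) f)
              (PS_decr_1 (V := C_NormedModule) g)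
              (decr_quotient f F) (decr_quotient g G)).
    + apply has_expansion_decr, hF.
    + apply has_expansion_decr, hG.
    + intros x hx0 hx. unfold decr_quotient.
      destruct (Ceq_dec x (RtoC 0)) as [h|_]; [contradiction|].
      rewrite h0, (hFG x hx0 hx). reflexivity.
Qed.

(** The Lipschitz bound for the difference quotient says that it differs from [f 1] by at most
    [M * Cmod x], so it tends to [f 1]. *)
Lemma has_expansion_C_derive_0 (f : nat -> C) (r : R) (F : C -> C) :
  0 < r -> has_expansion f r F -> C_derive F (RtoC 0) = f 1%nat.
Proof.
  intros hr hF. apply is_C_derive_unique.
  split; [apply is_linear_scal_l|].
  intros x hx.
  (* The differential is required at every limit of the neighbourhood filter of 0; the only such
     limit is 0 itself. *)
  apply (is_filter_lim_locally_unique (V := AbsRing_NormedModule C_AbsRing)) in hx.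
  rewrite <- hx. clear x hx. intros eps.
  assert (hF1 := has_expansion_decr _ _ _ hF).
  destruct (has_expansion_lipschitz_0 _ _ _ hr hF1) as (M & rho & hrho & hM).
  assert (hM0 := Rabs_pos M). assert (hMa := Rle_abs M).
  assert (heps := cond_pos eps).
  assert (hd : 0 < Rmin rho (eps / (Rabs M + 1)))
    by (apply Rmin_pos; [lra|apply Rdiv_lt_0_compat; lra]).
  exists (mkposreal _ hd). intros x hx. change C in x.
  change (Cmod (x - RtoC 0) < Rmin rho (eps / (Rabs M + 1))) in hx.
  rewrite C_norm_Cmod.
  change (Cmod ((F x - F (RtoC 0)) - (x - RtoC 0) * f 1%nat)
          <= eps * Cmod (x - RtoC 0)).
  replace (x - RtoC 0)%C with x in * by ring.
  assert (hx1 := Rlt_le_trans _ _ _ hx (Rmin_l _ _)).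
  assert (hx2 := Rlt_le_trans _ _ _ hx (Rmin_r _ _)).
  specialize (hM x hx1).
  unfold decr_quotient, PS_decr_1 in hM.
  rewrite (has_expansion_0 _ _ _ hr hF).
  destruct (Ceq_dec x (RtoC 0)) as [->|hx0].
  - rewrite (has_expansion_0 _ _ _ hr hF).
    replace (f 0%nat - f 0%nat - RtoC 0 * f 1%nat)%C with (RtoC 0) by ring.
    rewrite Cmod_0. lra.
  - replace (F x - f 0%nat - x * f 1%nat)%C
      with (((F x - f 0%nat) / x - f 1%nat) * x)%C by (field; auto).
    rewrite Cmod_mult. apply Rmult_le_compat_r; [apply Cmod_ge_0|].
    apply Rle_trans with (1 := hM).
    apply Rle_trans with ((Rabs M + 1) * (eps / (Rabs M + 1))).
    + assert (h := Cmod_ge_0 x).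
      apply Rle_trans with ((Rabs M + 1) * Cmod x);
        [apply Rmult_le_compat_r|apply Rmult_le_compat_l]; lra.
    + right. field. lra.
Qed.

(** * Binet's formula and the (s,t)-derivative *)

Lemma st_sqrt_disc_sqr (s t : R) :
  (st_sqrt_disc s t * st_sqrt_disc s t)%C = RtoC (s ^ 2 + 4 * t).
Proof.
  unfold st_sqrt_disc, Cmult, RtoC. cbn [fst snd].
  destruct (Rle_lt_dec 0 (s ^ 2 + 4 * t)) as [h|h].
  - rewrite (sqrt_neg_0 (- _)) by lra. rewrite sqrt_def by exact h.
    f_equal; ring.
  - rewrite (sqrt_neg_0 (s ^ 2 + 4 * t)) by lra. rewrite sqrt_def by lra.
    f_equal; ring.
Qed.

(** Both numbers are roots of [X ^ 2 = s X + t], the characteristic equation of the recurrence for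
    [stnum]. *)
Lemma phi_sqr (s t : R) :
  (phi s t * phi s t = RtoC s * phi s t + RtoC t)%C /\
  (phi' s t * phi' s t = RtoC s * phi' s t + RtoC t)%C.
Proof.
  assert (h := st_sqrt_disc_sqr s t).
  assert (h2 : RtoC 2 <> RtoC 0) by (intros h2; apply RtoC_inj in h2; lra).
  assert (h4 : RtoC 4 = (RtoC 2 * RtoC 2)%C)
    by (rewrite <- RtoC_mult; f_equal; ring).
  rewrite RtoC_plus, RtoC_pow, RtoC_mult, h4 in h.
  unfold phi, phi'. set (d := st_sqrt_disc s t) in *.
  (* Eliminating [t] in favour of the root [d] leaves a rational identity in [s] and [d]. *)
  assert (ht : RtoC t = ((d * d - RtoC s ^ 2) / (RtoC 2 * RtoC 2))%C)
    by (rewrite h; field; exact h2).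
  (* [field] would treat [RtoC 2] as an atom, but the identity needs its value. *)
  assert (h11 : RtoC 2 = (1 + 1)%C) by (rewrite <- RtoC_plus; reflexivity).
  rewrite ht. rewrite h11 in *.
  split; field; exact h2.
Qed.

(** Both sides satisfy the same second-order recurrence, so two consecutive indices are carried
    through the induction. The product form avoids dividing by [phi - phi']. *)
Lemma phi_binet (s t : R) (n : nat) :
  (phi s t ^ n - phi' s t ^ n = (phi s t - phi' s t) * RtoC (stnum s t n))%C.
Proof.
  enough (h : forall m,
    (phi s t ^ m - phi' s t ^ m = (phi s t - phi' s t) * RtoC (stnum s t m))%C /\
    (phi s t ^ S m - phi' s t ^ S m
     = (phi s t - phi' s t) * RtoC (stnum s t (S m)))%C) by apply h.
  destruct (phi_sqr s t) as [hp hq].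
  induction m as [|m [IH1 IH2]].
  - simpl. split; ring.
  - split; [exact IH2|].
    change (stnum s t (S (S m))) with (s * stnum s t (S m) + t * stnum s t m).
    rewrite RtoC_plus, !RtoC_mult.
    rewrite Cmult_plus_distr_l.
    replace ((phi s t - phi' s t) * (RtoC s * RtoC (stnum s t (S m))))%C
      with (RtoC s * (phi s t ^ S m - phi' s t ^ S m))%C by (rewrite IH2; ring).
    replace ((phi s t - phi' s t) * (RtoC t * RtoC (stnum s t m)))%C
      with (RtoC t * (phi s t ^ m - phi' s t ^ m))%C by (rewrite IH1; ring).
    rewrite !Cpow_S.
    rewrite !Cmult_assoc, hp, hq. ring.
Qed.

Lemma PS_st_derive_coef (s t : R) (f : nat -> C) (n : nat) :
  phi s t <> phi' s t ->
  PS_st_derive s t f n = (RtoC (stnum s t (S n)) * f (S n))%C.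
Proof.
  intros hphi.
  assert (hd : (phi s t - phi' s t)%C <> RtoC 0)
    by (intros h; apply hphi, Ceq_minus, h).
  change (/ (phi s t - phi' s t) *
          (phi s t ^ S n * f (S n) - phi' s t ^ S n * f (S n))
          = RtoC (stnum s t (S n)) * f (S n))%C.
  replace (phi s t ^ S n * f (S n) - phi' s t ^ S n * f (S n))%C
    with ((phi s t ^ S n - phi' s t ^ S n) * f (S n))%C by ring.
  rewrite phi_binet. field. exact hd.
Qed.

(** Links the pointwise operator to the formal one. At 0 the two agree because [{1} = 1]; elsewhere
    the expansions at [phi x] and [phi' x] are subtracted and divided by [x]. *)
Lemma st_derive_expansion (s t : R) (f : nat -> C) (r : R) (F : C -> C) (x : C) :
  phi s t <> phi' s t -> 0 < r -> has_expansion f r F ->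
  Cmod (phi s t * x)%C < r -> Cmod (phi' s t * x)%C < r ->
  is_pseries (K := C_AbsRing) (V := C_NormedModule)
    (PS_st_derive s t f) x (st_derive s t F x).
Proof.
  intros hphi hr hF hx hx'. unfold st_derive.
  destruct (Ceq_dec x (RtoC 0)) as [->|hx0].
  - rewrite (has_expansion_C_derive_0 _ _ _ hr hF).
    replace (f 1%nat) with (PS_st_derive s t f 0%nat)
      by (rewrite PS_st_derive_coef by exact hphi; simpl; ring).
    apply (is_pseries_0 (K := C_AbsRing) (V := C_NormedModule)).
  - assert (hd : (phi s t - phi' s t)%C <> RtoC 0)
      by (intros h; apply hphi, Ceq_minus, h).
    assert (hdiff := is_pseries_minus (K := C_AbsRing) (V := C_NormedModule)
      _ _ _ _ _ (is_pseries_dilate _ _ _ _ (hF _ hx))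
                 (is_pseries_dilate _ _ _ _ (hF _ hx'))).
    apply (is_pseries_decr_1 (K := C_AbsRing) (V := C_NormedModule)
             _ x (/ x)%C _ (Cinv_l x hx0)) in hdiff.
    apply (is_pseries_scal (K := C_AbsRing) (V := C_NormedModule)
             (/ (phi s t - phi' s t))%C _ _ _ (Cmult_comm _ _)) in hdiff.
    match type of hdiff with is_pseries _ _ ?l =>
      replace ((F (phi s t * x) - F (phi' s t * x))
               / ((phi s t - phi' s t) * x))%C with l; [exact hdiff|] end.
    (* The term [1 * f 0 - 1 * f 0] is the constant coefficient removed by [PS_decr_1]; it
       vanishes. *)
    change (/ (phi s t - phi' s t) *
      (/ x * ((F (phi s t * x) - F (phi' s t * x)) -
        (1 * f 0%nat - 1 * f 0%nat)))
      = (F (phi s t * x) - F (phi' s t * x)) / ((phi s t - phi' s t) * x))%C.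
    field. split; assumption.
Qed.

Lemma oplus_pow_neq_0 (a b u : C) (n : nat) :
  (forall k : nat, (a + b * u ^ k)%C <> RtoC 0) -> oplus_pow a b u n <> RtoC 0.
Proof.
  intros hab. induction n as [|n IH]; simpl.
  - apply C1_nz.
  - apply Cmult_neq_0; [exact IH|apply hab].
Qed.

Lemma stfact_neq_0 (s t : R) (n : nat) :
  (forall k : nat, (1 <= k)%nat -> stnum s t k <> 0) -> stfact s t n <> 0.
Proof.
  intros hnum. induction n as [|n IH].
  - simpl. lra.
  - apply Rmult_integral_contrapositive_currified;
      [exact IH|apply hnum; lia].
Qed.

(** * The coefficient recurrence *)

(** This is the homogeneous recurrence with [alpha = 1]; dilating by [alpha] later supplies the
    missing factor. *)
Lemma st_exp_rec (s t : R) (a b u : C) (n : nat) :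
  (forall k : nat, (1 <= k)%nat -> stnum s t k <> 0) ->
  (RtoC (stnum s t (S n)) * st_exp s t a b u (S n)
   = (a + b * u ^ n) * st_exp s t a b u n)%C.
Proof.
  intros hnum.
  assert (h1 := stfact_neq_0 s t n hnum).
  assert (h2 := hnum (S n) ltac:(lia)).
  unfold st_exp.
  change (stfact s t (S n)) with (stfact s t n * stnum s t (S n)).
  rewrite RtoC_mult. simpl oplus_pow.
  field. split; intros h; apply RtoC_inj in h; contradiction.
Qed.

(** Passing from [n] to [S n] multiplies each old summand by [alpha] and adds one with [k = n],
    which after multiplication by the outer factors is exactly [bn n]. *)
Lemma st_particular_rec (s t : R) (a b u alpha : C) (bn : nat -> C) (n : nat) :
  (forall k : nat, (1 <= k)%nat -> stnum s t k <> 0) ->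
  (forall k : nat, (a + b * u ^ k)%C <> RtoC 0) ->
  (RtoC (stnum s t (S n)) * st_particular s t a b u alpha bn (S n)
   = alpha * (a + b * u ^ n) * st_particular s t a b u alpha bn n + bn n)%C.
Proof.
  intros hnum hab.
  assert (h1 : RtoC (stfact s t n) <> RtoC 0)
    by (intros h; apply RtoC_inj in h; now apply (stfact_neq_0 s t n hnum)).
  assert (h2 : RtoC (stnum s t (S n)) <> RtoC 0)
    by (intros h; apply RtoC_inj in h; now apply (hnum (S n)); [lia|]).
  assert (h3 := oplus_pow_neq_0 a b u n hab).
  assert (h4 := hab n).
  unfold st_particular at 1.
  change (stfact s t (S n)) with (stfact s t n * stnum s t (S n)).
  rewrite RtoC_mult.
  replace (S n - 1)%nat with n by lia.
  (* Index 0 is separate: there the series has the value 0, an empty sum that [sum_n] cannot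
     express. *)
  destruct n as [|n].
  - rewrite sum_O. simpl in *. rewrite Cmult_1_r in *. field. exact h4.
  - rewrite sum_Sn.
    rewrite (sum_n_ext_loc _ (fun k => mult alpha
      (RtoC (stfact s t k) * alpha ^ (S n - k - 1)
       / oplus_pow a b u (k + 1) * bn k)%C)).
    + rewrite sum_n_mult_l.
      unfold st_particular. replace (S n - 1)%nat with n by lia.
      set (sigma := sum_n _ n).
      change (@mult C_Ring) with Cmult. change (@plus C_AbelianMonoid) with Cplus.
      (* In the new summand the power of [alpha] is 0 and the denominator is the outer [oplus_pow],
         so both disappear. *)
      replace (S (S n) - S n - 1)%nat with 0%nat by lia.
      replace (S n + 1)%nat with (S (S n)) by lia.
      change (oplus_pow a b u (S (S n)))
        with (oplus_pow a b u (S n) * (a + b * u ^ S n))%C.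
      change (alpha ^ 0)%C with (RtoC 1).
      field. repeat split; assumption.
    + intros k hk. change (@mult C_Ring) with Cmult.
      replace (S (S n) - k - 1)%nat with (S (S n - k - 1)) by lia.
      rewrite Cpow_S.
      match goal with |- ?l = ?r => change (@eq C l r) end.
      unfold Cdiv. ring.
Qed.

Lemma st_solution_rec (s t : R) (a b u alpha a0 : C) (bn : nat -> C) (n : nat) :
  (forall k : nat, (1 <= k)%nat -> stnum s t k <> 0) ->
  (forall k : nat, (a + b * u ^ k)%C <> RtoC 0) ->
  (RtoC (stnum s t (S n)) * st_solution s t a b u alpha a0 bn (S n)
   = alpha * (a + b * u ^ n) * st_solution s t a b u alpha a0 bn n + bn n)%C.
Proof.
  intros hnum hab.
  assert (he := st_exp_rec s t a b u n hnum).
  assert (hp := st_particular_rec s t a b u alpha bn n hnum hab).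
  change (RtoC (stnum s t (S n)) *
     (a0 * (alpha ^ S n * st_exp s t a b u (S n))
      + st_particular s t a b u alpha bn (S n))
   = alpha * (a + b * u ^ n) *
     (a0 * (alpha ^ n * st_exp s t a b u n)
      + st_particular s t a b u alpha bn n) + bn n)%C.
  rewrite Cmult_plus_distr_l, hp, Cpow_S.
  replace (RtoC (stnum s t (S n)) * (a0 * (alpha * alpha ^ n * st_exp s t a b u (S n))))%C
    with (a0 * alpha * alpha ^ n * (RtoC (stnum s t (S n)) * st_exp s t a b u (S n)))%C
    by ring.
  rewrite he. ring.
Qed.

Lemma st_solution_0 (s t : R) (a b u alpha a0 : C) (bn : nat -> C) :
  st_solution s t a b u alpha a0 bn 0%nat = a0.
Proof.
  change (a0 * (1 * (1 / 1)) + 0 = a0)%C. field.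
Qed.

(** * The formal equation and its analytic counterpart *)

Definition PS_rhs (a b u alpha : C) (bn y : nat -> C) : nat -> C :=
  PS_plus (V := C_NormedModule)
    (PS_scal (V := C_NormedModule) alpha
       (PS_plus (V := C_NormedModule)
          (PS_scal (V := C_NormedModule) a y)
          (PS_scal (V := C_NormedModule) b (PS_dilate u y))))
    bn.

Lemma PS_rhs_coef (a b u alpha : C) (bn y : nat -> C) (n : nat) :
  PS_rhs a b u alpha bn y n = (alpha * (a + b * u ^ n) * y n + bn n)%C.
Proof.
  change (alpha * (a * y n + b * (u ^ n * y n)) + bn n
          = alpha * (a + b * u ^ n) * y n + bn n)%C.
  ring.
Qed.

Lemma PS_rhs_expansion (a b u alpha : C) (bn c : nat -> C) (y beta : C -> C)
    (r rb : R) (x : C) :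
  has_expansion c r y -> has_expansion bn rb beta ->
  Cmod x < rb -> Cmod x < r -> Cmod (u * x)%C < r ->
  is_pseries (K := C_AbsRing) (V := C_NormedModule) (PS_rhs a b u alpha bn c) x
    (alpha * (a * y x + b * y (u * x)%C) + beta x)%C.
Proof.
  intros hy hbeta hxb hx hux.
  apply (is_pseries_plus (K := C_AbsRing) (V := C_NormedModule)); [|now apply hbeta].
  apply (is_pseries_scal (K := C_AbsRing) (V := C_NormedModule)); [apply Cmult_comm|].
  apply (is_pseries_plus (K := C_AbsRing) (V := C_NormedModule));
    (apply (is_pseries_scal (K := C_AbsRing) (V := C_NormedModule)); [apply Cmult_comm|]).
  - now apply hy.
  - now apply is_pseries_dilate, hy.
Qed.

Lemma PS_st_equation_iff (s t : R) (a b u alpha a0 : C) (bn y : nat -> C) :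
  phi s t <> phi' s t ->
  (forall n : nat, (1 <= n)%nat -> stnum s t n <> 0) ->
  (forall k : nat, (a + b * u ^ k)%C <> RtoC 0) ->
  ((forall n : nat, PS_st_derive s t y n = PS_rhs a b u alpha bn y n)
   /\ y 0%nat = a0)
  <-> (forall n : nat, y n = st_solution s t a b u alpha a0 bn n).
Proof.
  intros hphi hnum hab. split.
  - intros [heq h0]. induction n as [|n IH].
    + rewrite st_solution_0. exact h0.
    + assert (hn : RtoC (stnum s t (S n)) <> RtoC 0)
        by (intros h; apply RtoC_inj in h; now apply (hnum (S n)); [lia|]).
      specialize (heq n).
      rewrite PS_st_derive_coef, PS_rhs_coef, IH in heq by exact hphi.
      rewrite <- st_solution_rec in heq by assumption.
      (* Both candidates for the next coefficient have the same product with [{n+1}], which is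
         cancelled by its inverse. *)
      rewrite <- (Cmult_1_l (y (S n))), <- (Cinv_l _ hn), <- Cmult_assoc, heq.
      rewrite Cmult_assoc, (Cinv_l _ hn). apply Cmult_1_l.
  - intros hy. split.
    + intros n. rewrite PS_st_derive_coef, PS_rhs_coef, !hy by exact hphi.
      now apply st_solution_rec.
    + rewrite hy. apply st_solution_0.
Qed.

Lemma dilated_disc (c : C) (r : R) :
  0 < r -> exists d : R, 0 < d /\ forall x : C, Cmod x < d -> Cmod (c * x)%C < r.
Proof.
  intros hr. assert (hc := Cmod_ge_0 c).
  (* The [+ 1] covers [c = 0]. *)
  exists (r / (Cmod c + 1)). split; [apply Rdiv_lt_0_compat; lra|].
  intros x hx. rewrite Cmod_mult. assert (h := Cmod_ge_0 x).
  apply Rle_lt_trans with ((Cmod c + 1) * Cmod x);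
    [apply Rmult_le_compat_r; lra|].
  replace r with ((Cmod c + 1) * (r / (Cmod c + 1))) by (field; lra).
  apply Rmult_lt_compat_l; lra.
Qed.

Theorem theorem4 (s t : R) (a b u alpha a0 : C) (bn : nat -> C)
    (hs : s <> 0) (ht : t <> 0)
    (hphi : phi s t <> phi' s t)
    (hnum : forall n : nat, (1 <= n)%nat -> stnum s t n <> 0)
    (hab : forall k : nat, (a + b * u ^ k)%C <> RtoC 0) :
  (* formal power series *)
  (forall y : nat -> C,
     ((forall n : nat,
         PS_st_derive s t y n
         = PS_plus (V := C_NormedModule)
             (PS_scal (V := C_NormedModule) alpha
                (PS_plus (V := C_NormedModule)
                   (PS_scal (V := C_NormedModule) a y)
                   (PS_scal (V := C_NormedModule) b (PS_dilate u y))))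
             bn n)
      /\ y 0%nat = a0)
     <-> (forall n : nat, y n = st_solution s t a b u alpha a0 bn n))
  /\
  (* analytic functions, on any common domain of convergence *)
  (forall (y beta : C -> C) (r rb : R),
     0 < r -> 0 < rb ->
     (exists c : nat -> C, has_expansion c r y) ->
     has_expansion bn rb beta ->
     ((forall x : C,
         Cmod x < rb -> Cmod x < r -> Cmod (u * x)%C < r ->
         Cmod (phi s t * x)%C < r -> Cmod (phi' s t * x)%C < r ->
         st_derive s t y x
         = (alpha * (a * y x + b * y (u * x)%C) + beta x)%C)
      /\ y (RtoC 0) = a0)
     <-> has_expansion (st_solution s t a b u alpha a0 bn) r y).
Proof.
  split.
  - intros y. now apply PS_st_equation_iff.
  - intros y beta r rb hr hrb [c hc] hbeta. split.
    + intros [heq h0].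
      (* Dilation by [u], [phi] or [phi'] may leave the disc of radius [r], so coefficients are
         compared on a smaller disc where every argument stays inside. *)
      destruct (dilated_disc u r hr) as (d1 & hd1 & hu).
      destruct (dilated_disc (phi s t) r hr) as (d2 & hd2 & hp).
      destruct (dilated_disc (phi' s t) r hr) as (d3 & hd3 & hp').
      set (d := Rmin (Rmin r rb) (Rmin d1 (Rmin d2 d3))).
      assert (hd : 0 < d) by (repeat apply Rmin_pos; assumption).
      assert (hle : d <= r /\ d <= rb /\ d <= d1 /\ d <= d2 /\ d <= d3).
      { repeat split; unfold d.
        - eapply Rle_trans; [apply Rmin_l|apply Rmin_l].
        - eapply Rle_trans; [apply Rmin_l|apply Rmin_r].
        - eapply Rle_trans; [apply Rmin_r|apply Rmin_l].
        - do 2 (eapply Rle_trans; [apply Rmin_r|]). apply Rmin_l.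
        - do 2 (eapply Rle_trans; [apply Rmin_r|]). apply Rmin_r. }
      assert (hcs : forall n, c n = st_solution s t a b u alpha a0 bn n).
      { apply PS_st_equation_iff; try assumption. split.
        - intros n.
          apply (has_expansion_coef_unique n _ _ d (st_derive s t y)
                   (fun x => alpha * (a * y x + b * y (u * x)%C) + beta x)%C hd).
          + intros x hx. apply (st_derive_expansion s t c r); auto;
              [apply hp|apply hp']; lra.
          + intros x hx. apply (PS_rhs_expansion _ _ _ _ _ _ _ _ r rb); auto;
              try apply hu; lra.
          + intros x _ hx. apply heq; try apply hu; try apply hp; try apply hp'; lra.
        - rewrite <- h0. symmetry. exact (has_expansion_0 _ _ _ hr hc). }
      (* Equality of coefficients carries the expansion back from the small disc to the full radius
         [r]. *)
      intros x hx. apply (is_pseries_ext _ _ _ _ hcs), hc, hx.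
    + intros hy.
      (* The closed form solves the formal equation; at each admissible [x] the two sides of the
         equation are then sums of one and the same series. *)
      destruct (proj2 (PS_st_equation_iff s t a b u alpha a0 bn _ hphi hnum hab)
                  (fun n => eq_refl)) as [heq h0].
      split.
      * intros x hxb hx hux hp hp'.
        apply (is_pseries_C_unique (PS_rhs a b u alpha bn
                 (st_solution s t a b u alpha a0 bn)) x).
        -- apply (is_pseries_ext _ _ _ _ heq).
           now apply (st_derive_expansion s t _ r).
        -- now apply (PS_rhs_expansion _ _ _ _ _ _ _ _ r rb).
      * rewrite (has_expansion_0 _ _ _ hr hy). exact h0.
Qed.
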